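(* Fix $\mathsf T\ge100$, $\mathsf b\in(0,1)$, $\eta_*\in(0,1/4)$, and let $\mu_0=\frac1n\sum_{i=1}^n\delta_{\lambda_i(0)}$ be supported on $(-\infty,0]$ with $\mu_0([-x,0])\ge\mathsf b x^{3/2}$ for all $\eta_*\le x\le\mathsf T^2$. Let $\mathfrak C=2^{21}/\mathsf b^2$ and $\mathfrak c=\mathsf b\,\mathfrak C^{-3/2}$. Fix real numbers $0<t\le\mathsf T$ and $0\le s\le t$, take $u\in\Lambda_t$, and write $z_r=z_r(u)=E_r+\kappa_r+\mathrm i\eta_r$ for $0\le r\le t$. Assume that $\kappa_s\le\mathsf T^2$. If $\kappa_t\ge0$, then $$\kappa_s-\kappa_t\ge\Big(\frac{\eta_s}{\eta_t}-1\Big)\kappa_t=(t-s)\,\operatorname{Im}[m_t(z_t)]\,\frac{\kappa_t}{\eta_t}\ge0 .$$ Moreover, if $\kappa_t\ge0$ and $\mathfrak C\sqrt{\eta_*}\le s\le t$, then $$\kappa_s^{1/2}-\kappa_t^{1/2}\ge\frac{\mathfrak c\,(t-s)}{4} .$$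
   Context: $m_0(z)=\int\frac{\mu_0(dx)}{x-z}$ for $z\in\mathbb H$ (upper half-plane). $\Lambda_t=\{z\in\mathbb H:\int\frac{\mu_0(dx)}{|z-x|^2}<\frac1t\}$ for $t>0$ and $\Lambda_0=\mathbb H$. $\mu_t=\mu_0\boxplus\mu_{\rm sc}^{(t)}$ is the free convolution of $\mu_0$ with the semicircle distribution $\frac{\sqrt{4t-x^2}}{2\pi t}\mathbf 1_{|x|\le2\sqrt t}dx$; its Stieltjes transform $m_t$ is determined by $m_t(z-tm_0(z))=m_0(z)$ for $z\in\Lambda_t$ (the map $z\mapsto z-tm_0(z)$ is a bijection $\Lambda_t\to\mathbb H$). $E_t=\max(\operatorname{supp}\mu_t)$. **Characteristic flow.** For $u\in\Lambda_t$ and $0\le r\le t$ (so $u\in\Lambda_r$), $z_r(u)=u-r\,m_0(u)$, and $\kappa_r=\operatorname{Re}z_r(u)-E_r$, $\eta_r=\operatorname{Im}z_r(u)$. *)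

(* Defs.v *)
From HB Require Import structures.
From mathcomp Require Import all_boot all_order all_algebra.
From mathcomp Require Import all_classical all_reals all_analysis.
From mathcomp Require Import complex.

Set Implicit Arguments.
Unset Strict Implicit.
Unset Printing Implicit Defensive.

Import Order.TTheory GRing.Theory Num.Theory.
Import numFieldNormedType.Exports.
Local Open Scope classical_set_scope.
Local Open Scope ring_scope.
Local Open Scope complex_scope.

Section empirical.
Local Open Scope ereal_scope.
Context (R : realType) (n : nat) (lam : 'I_n -> R).

Definition empirical (A : set (measurableTypeR R)) : \bar R :=
  (n%:R^-1)%:E * \sum_(i < n) \d_(lam i) A.

Let empirical0 : empirical set0 = 0.
Proof. by rewrite /empirical big1 ?mule0// => i _; rewrite measure0. Qed.

Let empirical_ge0 A : 0 <= empirical A.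
Proof. by rewrite /empirical mule_ge0// ?lee_fin ?invr_ge0//; exact: sume_ge0. Qed.

Let empirical_sigma_additive : semi_sigma_additive empirical.
Proof.
move=> F mF tF mUF; rewrite /empirical.
rewrite [X in X @ \oo --> _](_ : _ = (fun m =>
    (n%:R^-1)%:E * \sum_(i < n) \sum_(0 <= k < m) \d_(lam i) (F k))); last first.
  apply/funext => m; rewrite -ge0_sume_distrr; last first.
    by move=> k _; exact: sume_ge0.
  by rewrite exchange_big.
apply: cvgeZl => //; apply: cvg_nnesum => i _; first by near=> m; exact: sume_ge0.
exact: measure_semi_sigma_additive.
Unshelve. all: by end_near. Qed.

HB.instance Definition _ := isMeasure.Build _ _ _ empirical
  empirical0 empirical_ge0 empirical_sigma_additive.

End empirical.

Section definitions.
Context {R : realType}.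
Local Notation measureR := {measure set (measurableTypeR R) -> \bar R}.

(* For a finite measure and Im z != 0 both integrands are bounded, so neither
   [Rintegral] takes its default value. *)
Definition stieltjes (mu : measureR) (z : R[i]) : R[i] :=
  (\int[mu]_x complex.Re ((x%:C - z)^-1))
    +i* (\int[mu]_x complex.Im ((x%:C - z)^-1)).

Definition msupport (mu : measureR) : set R :=
  [set x | forall U : set R, open U -> U x -> (0 < mu U)%E].

(* The maximum of the support, whenever the support is nonempty and bounded
   above (it is closed, so that its supremum is then attained). *)
Definition edge (mu : measureR) : R := sup (msupport mu).

(* The guard [0 < t] makes [Lambda mu0 0] the whole upper half-plane. *)
Definition Lambda (mu0 : measureR) (t : R) : set R[i] :=
  [set z | 0 < complex.Im z /\
    (0 < t ->
     (\int[mu0]_x ((ComplexField.Normc.normc (z - x%:C) ^+ 2)^-1)%R%:E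
        < (1 / t)%R%:E)%E)].

Definition flow (mu0 : measureR) (r : R) (u : R[i]) : R[i] :=
  u - r%:C * stieltjes mu0 u.

(* [mu] is the free convolution of [mu0] with the semicircle distribution of
   variance [t]: as [flow mu0 t] maps [Lambda mu0 t] bijectively onto the upper
   half-plane, the equation prescribes the Stieltjes transform of [mu] there,
   which determines [mu]. *)
Definition is_semicircle_convolution (mu0 : measureR) (t : R) (mu : measureR) :=
  forall z, Lambda mu0 t z -> stieltjes mu (flow mu0 t z) = stieltjes mu0 z.

Definition flow_kappa (mu0 : measureR) (mu : R -> probability (measurableTypeR R) R)
    (u : R[i]) (r : R) : R :=
  complex.Re (flow mu0 r u) - edge (mu r).

Definition flow_eta (mu0 : measureR) (u : R[i]) (r : R) : R := complex.Im (flow mu0 r u).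

End definitions.

(* Main.v *)
Require Import Defs.
From HB Require Import structures.
From mathcomp Require Import all_boot all_order all_algebra.
From mathcomp Require Import all_classical all_reals all_analysis.
From mathcomp Require Import complex.
From mathcomp Require Import measurable_realfun ring lra.

Set Implicit Arguments.
Unset Strict Implicit.
Unset Printing Implicit Defensive.

Import Order.TTheory GRing.Theory Num.Theory.
Import numFieldNormedType.Exports.
Local Open Scope classical_set_scope.
Local Open Scope ring_scope.
Local Open Scope complex_scope.

(** Everything is read off from the subordination formula and the convexity of
    the flow on the real axis.  Write m0 for the Stieltjes transform of mu0 and,
    at a point a + iv,
      A = mean of (a - y) / |a + iv - y|^2,   S = mean of |a + iv - y|^-2,
    so that m0 = - A + i v S and z_r = (a + r A) + i v (1 - r S).

    One convexity inequality (tangent_le) governs the whole proof: for x to the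
    right of the atoms, A(x) - A(u) >= (Re u - x) S(u).  With u real it is the
    convexity of x |-> A(x), hence of G_r(x) = x + r A(x); with u complex it
    compares the velocity of z_r with that of the edge.

    The edge E_r of mu_r is the minimum of G_r over x to the right of the atoms,
    reached at the critical point x_r where r S(x_r) = 1 (edge_le,
    edge_critical).  To the right of G_r(x_r) the equation
    m_r(G_r(z)) = m0(z) bounds Im m_r at height l by a multiple of l, so an
    interval of length l has mass O(l^2); halving it k times turns this bound
    into O(l^2 / 2^k), so its mass is zero.  Conversely, if mu_r stopped before
    G_r(x_r), the density Im m_r / Im z would stay bounded near that point,
    whereas along z = x_r + i eps it equals S / (1 - r S), which blows up.

    As E_s <= G_s(x_t) and E_t = G_t(x_t), the function kappa satisfies
    kappa_s >= kappa_t + (t - s) D_t with D_t = A(x_t) - A(u)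
    (flow_kappa_step).  The first claim is then the convexity inequality
    multiplied out.  For the second, the lower bound on the mass of mu0 near 0
    gives D_r >= (b / 6) sqrt kappa_r (velocity_gap_ge), and iterating the step
    on finer and finer partitions integrates this differential inequality to
    sqrt kappa_s - sqrt kappa_t >= (b / 12) (t - s) (sqrt_decay).  The constant
    c / 4 of the statement is smaller than b / 12. *)

(** * Averages over the atoms and the convexity inequality *)

Section averages.
Context {R : realType} {n : nat} (hn : (0 < n)%N) (lam : 'I_n -> R).
Implicit Types (F G : R -> R) (a v w x r k : R).

Definition avg F : R := n%:R^-1 * \sum_(i < n) F (lam i).

Let n_gt0 : 0 < n%:R :> R. Proof. by rewrite ltr0n. Qed.

Lemma avgZ k F : avg (fun y => k * F y) = k * avg F.
Proof. by rewrite /avg -mulr_sumr mulrCA. Qed.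

Lemma avgB F G : avg (fun y => F y - G y) = avg F - avg G.
Proof. by rewrite /avg sumrB mulrBr. Qed.

Lemma avg_cst k : avg (fun=> k) = k.
Proof.
by rewrite /avg sumr_const card_ord -(mulr_natl k) mulrA mulVf ?mul1r ?gt_eqF.
Qed.

Lemma eq_avg F G : (forall i, F (lam i) = G (lam i)) -> avg F = avg G.
Proof. by move=> FG; rewrite /avg (eq_bigr (fun i => G (lam i))). Qed.

Lemma ler_avg F G : (forall i, F (lam i) <= G (lam i)) -> avg F <= avg G.
Proof. by move=> FG; rewrite ler_pM2l ?invr_gt0//; exact: ler_sum. Qed.

Lemma ltr_avg F G : (forall i, F (lam i) < G (lam i)) -> avg F < avg G.
Proof.
move=> FG; rewrite ltr_pM2l ?invr_gt0//.
by apply: ltr_sum => //; apply/hasP; exists (Ordinal hn); rewrite ?mem_index_enum.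
Qed.

Lemma avg_ge0 F : (forall i, 0 <= F (lam i)) -> 0 <= avg F.
Proof. by move=> F0; rewrite -(avg_cst 0); exact: ler_avg. Qed.

Lemma avg_ge_atom F i : (forall j, 0 <= F (lam j)) -> n%:R^-1 * F (lam i) <= avg F.
Proof.
move=> F0; rewrite ler_pM2l ?invr_gt0// (bigD1 i)//= lerDl.
exact: sumr_ge0.
Qed.

(** The real part of m0 at [a + iv] is [- mean_inv a v], its imaginary part is
    [v * mean_invsq a v].  The height [v = 0] is allowed, and there [mean_inv]
    is the average of [(a - y)^-1]. *)
Definition mean_inv a v := avg (fun y => (a - y) / ((a - y) ^+ 2 + v ^+ 2)).
Definition mean_invsq a v := avg (fun y => ((a - y) ^+ 2 + v ^+ 2)^-1).

Definition above w := forall i, lam i < w.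
Definition off_atoms a v := forall i, 0 < (a - lam i) ^+ 2 + v ^+ 2.

Lemma above_off a : above a -> forall v, off_atoms a v.
Proof. by move=> ha v i; rewrite ltr_pwDl ?sqr_ge0// exprn_gt0// subr_gt0. Qed.

Lemma off_atoms_upper a v : 0 < v -> off_atoms a v.
Proof. by move=> v0 i; rewrite ltr_wpDl ?sqr_ge0// exprn_gt0. Qed.

Let tangent_pointwise p q v : 0 < p -> 0 < q ^+ 2 + v ^+ 2 ->
  p / (p ^+ 2 + 0 ^+ 2) - q / (q ^+ 2 + v ^+ 2) - (q - p) * (q ^+ 2 + v ^+ 2)^-1
  = ((q - p) ^+ 2 + v ^+ 2) / (p * (q ^+ 2 + v ^+ 2)).
Proof.
move=> p0 q0; have := gt_eqF p0; have := gt_eqF q0.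
rewrite expr0n/= addr0 => qE pE; field.
by rewrite qE pE.
Qed.

(* The defect in the convexity inequality is an average of positive terms. *)
Let tangent_sum x a v : above x -> off_atoms a v ->
  mean_inv x 0 - mean_inv a v - (a - x) * mean_invsq a v =
  avg (fun y => ((a - x) ^+ 2 + v ^+ 2) / ((x - y) * ((a - y) ^+ 2 + v ^+ 2))).
Proof.
move=> hx ha; rewrite -avgZ -!avgB; apply: eq_avg => i.
have -> : a - x = (a - lam i) - (x - lam i) by ring.
by rewrite tangent_pointwise// subr_gt0.
Qed.

(** With [p = x - y > 0] and [q = a - y] this is the average over y of
    [1 / p - q / (q^2 + v^2) >= (q - p) / (q^2 + v^2)], which after clearing
    denominators reads [(q - p)^2 + v^2 >= 0]. *)
Lemma tangent_le x a v : above x -> off_atoms a v ->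
  (a - x) * mean_invsq a v <= mean_inv x 0 - mean_inv a v.
Proof.
move=> hx ha; rewrite -subr_ge0 tangent_sum//; apply: avg_ge0 => i.
apply: divr_ge0; first by rewrite addr_ge0 ?sqr_ge0.
by rewrite ltW// mulr_gt0 ?subr_gt0.
Qed.

Lemma tangent_lt x a v : above x -> 0 < v ->
  (a - x) * mean_invsq a v < mean_inv x 0 - mean_inv a v.
Proof.
move=> hx v0; have ha := off_atoms_upper a v0.
rewrite -subr_gt0 tangent_sum// -(avg_cst 0); apply: ltr_avg => i.
by rewrite divr_gt0// ?mulr_gt0 ?subr_gt0// ltr_wpDl ?sqr_ge0// exprn_gt0.
Qed.

Lemma mean_invsq_gt0 a v : off_atoms a v -> 0 < mean_invsq a v.
Proof. by move=> ha; rewrite -(avg_cst 0); apply: ltr_avg => i; rewrite invr_gt0. Qed.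

Lemma mean_invsq_anti a b v v' : above a -> a <= b -> v ^+ 2 <= v' ^+ 2 ->
  mean_invsq b v' <= mean_invsq a v.
Proof.
move=> ha ab vv; apply: ler_avg => i; have hi := ha i.
by rewrite lef_pV2 ?posrE; nra.
Qed.

Lemma cvg_avg (F : R -> R -> R) w :
  (forall i, {for w, continuous (F ^~ (lam i))}) ->
  {for w, continuous (fun w => avg (F w))}.
Proof.
move=> cF; apply: cvgM; first exact: cvg_cst.
apply: cvg_big => [|i _]; [exact: add_continuous|exact: cF].
Qed.

Lemma continuous_mean_invsq a v : off_atoms a v ->
  {for a, continuous (mean_invsq ^~ v)}.
Proof.
move=> ha; apply: cvg_avg => i; apply: cvgV; first by rewrite gt_eqF ?ha.
apply: cvgD; last exact: cvg_cst.
apply: cvgM; apply: cvgB; try exact: cvg_cst; exact: cvg_id.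
Qed.

Lemma continuous_mean_inv a v : off_atoms a v ->
  {for a, continuous (mean_inv ^~ v)}.
Proof.
move=> ha; apply: cvg_avg => i; apply: cvgM.
  by apply: cvgB; [exact: cvg_id|exact: cvg_cst].
apply: cvgV; first by rewrite gt_eqF ?ha.
apply: cvgD; last exact: cvg_cst.
apply: cvgM; apply: cvgB; try exact: cvg_cst; exact: cvg_id.
Qed.

Lemma exists_top_atom : exists i, forall j, lam j <= lam i.
Proof.
exists [arg max_(i > Ordinal hn) lam i]%O => j.
by case: arg_maxP => // i _; apply.
Qed.

(** At distance [sqrt (r / n)] from the largest atom that atom alone already
    contributes [1 / r], and at distance [sqrt r] no atom contributes more than
    its share of [1 / r]; the critical point lies in between. *)
Lemma exists_critical r : 0 < r -> exists2 x, above x & r * mean_invsq x 0 = 1.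
Proof.
move=> r0; have [i0 hi0] := exists_top_atom.
have ab d : 0 < d -> above (lam i0 + d).
  by move=> d0 j; rewrite (le_lt_trans (hi0 j))// ltrDl.
set lo := Num.sqrt (r / n%:R); set hi := Num.sqrt r.
have lo0 : 0 < lo by rewrite sqrtr_gt0 divr_gt0.
have lohi : lo <= hi.
  by rewrite ler_wsqrtr// ler_pdivrMr// ler_peMr ?ler1n// ltW.
have [|||x xin xE] := @IVT R (mean_invsq ^~ 0) (lam i0 + lo) (lam i0 + hi) r^-1.
- by rewrite lerD2l.
- apply: continuous_in_subspaceT => x; rewrite inE/= in_itv/= => /andP[x1 _].
  apply: continuous_mean_invsq; apply: above_off => j.
  by rewrite (lt_le_trans _ x1)//; exact: ab.
- rewrite ge_min le_max; apply/andP; split; apply/orP; [right|left].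
    rewrite -[leRHS]avg_cst; apply: ler_avg => j.
    rewrite lef_pV2 ?posrE//; last first.
      by apply: above_off; apply: ab; rewrite sqrtr_gt0.
    rewrite expr0n addr0 -[leLHS](sqr_sqrtr (ltW r0)).
    have := hi0 j; have : 0 <= hi by exact: sqrtr_ge0.
    by rewrite -/hi; nra.
  have loE : (lam i0 + lo - lam i0) ^+ 2 + 0 ^+ 2 = r / n%:R.
    by rewrite [lam i0 + lo]addrC addrK expr0n addr0 sqr_sqrtr// divr_ge0// ltW.
  have -> : r^-1 = n%:R^-1 * ((lam i0 + lo - lam i0) ^+ 2 + 0 ^+ 2)^-1.
    by rewrite loE invf_div mulrA mulVf ?mul1r// gt_eqF.
  apply: (@avg_ge_atom (fun y => ((lam i0 + lo - y) ^+ 2 + 0 ^+ 2)^-1)) => j.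
  by rewrite invr_ge0 ltW// above_off//; apply: ab.
exists x.
  move: xin; rewrite in_itv/= => /andP[x1 _] j.
  by rewrite (lt_le_trans _ x1)//; exact: ab.
by rewrite xE divff// gt_eqF.
Qed.

End averages.

(** * Integrals and transforms of the empirical measure *)

Section empirical_measure.
Context {R : realType} {n : nat} (lam : 'I_n -> R).
Implicit Types (a v x t r : R).

Let mu0 : {measure set (measurableTypeR R) -> \bar R} := empirical lam.

Lemma ge0_integral_empirical (f : R -> R) :
  measurable_fun setT f -> (forall x, 0 <= f x) ->
  (\int[mu0]_x (f x)%:E = (avg lam f)%:E)%E.
Proof.
move=> mf f0.
(* [msum] is indexed by nat, so the atoms are extended by a dummy value *)
pose pt k : measurableTypeR R := oapp lam 0 (insub k).
have n0 : 0 <= n%:R^-1 :> R by rewrite invr_ge0.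
pose m : {measure set (measurableTypeR R) -> \bar R} :=
  mscale (NngNum n0) (msum (fun k => \d_(pt k)) n).
have mf' : measurable_fun setT (EFin \o f : measurableTypeR R -> \bar R).
  exact/measurable_EFinP.
rewrite (@eq_measure_integral _ _ _ setT m); last first.
  move=> A _ _; rewrite /mu0 /m /= /empirical /mscale/= /msum.
  by under [in RHS]eq_bigr do rewrite /pt valK.
rewrite ge0_integral_mscale//=; last by move=> x _; rewrite lee_fin.
rewrite ge0_integral_measure_sum//; last by move=> x _; rewrite lee_fin.
under eq_bigr do rewrite integral_dirac// diracT mul1e /pt valK/=.
by rewrite sumEFin -EFinM.
Qed.

Lemma Rintegral_empirical (f : R -> R) :
  measurable_fun setT f -> \int[mu0]_x f x = avg lam f.
Proof.
move=> mf; rewrite /Rintegral integralE.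
have -> : (\int[mu0]_x (fun x => (f x)%:E)^\+ x
    = (avg lam (fun x => Num.max (f x) 0))%:E)%E.
  under eq_integral do rewrite funeposE -EFin_max.
  apply: ge0_integral_empirical; last by move=> x; rewrite le_max lexx orbT.
  exact: measurable_maxr.
have -> : (\int[mu0]_x (fun x => (f x)%:E)^\- x
    = (avg lam (fun x => Num.max (- f x) 0))%:E)%E.
  under eq_integral do rewrite funenegE -EFinN -EFin_max.
  apply: ge0_integral_empirical; last by move=> x; rewrite le_max lexx orbT.
  by apply: measurable_maxr => //; exact: measurableT_comp.
rewrite -EFinB/= -avgB; apply: eq_avg => i.
by case: (leP (f (lam i)) 0) => h; case: (leP (- f (lam i)) 0) => h'; lra.
Qed.

End empirical_measure.

Section kernels.
Context {R : realType}.
Implicit Types (a v x t r : R).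
Local Notation measureR := {measure set (measurableTypeR R) -> \bar R}.

Lemma Re_resolvent x a v :
  complex.Re ((x%:C - (a +i* v))^-1) = (x - a) / ((x - a) ^+ 2 + v ^+ 2).
Proof. by rewrite /GRing.inv/= sub0r sqrrN. Qed.

Lemma Im_resolvent x a v :
  complex.Im ((x%:C - (a +i* v))^-1) = v / ((x - a) ^+ 2 + v ^+ 2).
Proof. by rewrite /GRing.inv/= !sub0r sqrrN mulNr opprK. Qed.

Lemma sqr_normc_sub x a v :
  ComplexField.Normc.normc ((a +i* v) - x%:C) ^+ 2 = (a - x) ^+ 2 + v ^+ 2.
Proof. by rewrite /= subr0 sqr_sqrtr// addr_ge0 ?sqr_ge0. Qed.

Lemma denom_gt0 x a v : 0 < v -> 0 < (x - a) ^+ 2 + v ^+ 2.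
Proof. by move=> v0; rewrite ltr_wpDl ?sqr_ge0// exprn_gt0. Qed.

Lemma measurable_kernel (f : R -> R) a v : 0 < v -> continuous f ->
  measurable_fun setT (fun x => f x / ((x - a) ^+ 2 + v ^+ 2)).
Proof.
move=> v0 cf; apply: continuous_measurable_fun => x.
apply: cvgM; first exact: cf.
apply: cvgV; first by rewrite gt_eqF// denom_gt0.
apply: cvgD; last exact: cvg_cst.
apply: cvgM; apply: cvgB; try exact: cvg_cst; exact: cvg_id.
Qed.

Lemma stieltjesE (mu : measureR) a v : stieltjes mu (a +i* v) =
  (\int[mu]_x ((x - a) / ((x - a) ^+ 2 + v ^+ 2))) +i*
  (\int[mu]_x (v / ((x - a) ^+ 2 + v ^+ 2))).
Proof.
rewrite /stieltjes.
by congr (_ +i* _); apply: eq_Rintegral => x _; rewrite ?Re_resolvent ?Im_resolvent.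
Qed.

End kernels.

Section empirical_transform.
Context {R : realType} {n : nat} (hn : (0 < n)%N) (lam : 'I_n -> R).
Implicit Types (a v x t r : R).
Let mu0 : {measure set (measurableTypeR R) -> \bar R} := empirical lam.

Lemma stieltjes_empirical a v : 0 < v ->
  stieltjes mu0 (a +i* v) = (- mean_inv lam a v) +i* (v * mean_invsq lam a v).
Proof.
move=> v0; rewrite stieltjesE; congr (_ +i* _).
  rewrite Rintegral_empirical; last first.
    apply: measurable_kernel => // x.
    by apply: cvgB; [exact: cvg_id|exact: cvg_cst].
  rewrite -[RHS]mulN1r /mean_inv -avgZ; apply: eq_avg => i.
  by rewrite mulN1r -mulNr opprB -(sqrrN (a - _)) opprB.
rewrite Rintegral_empirical; last first.
  by apply: measurable_kernel => // x; exact: cvg_cst.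
by rewrite /mean_invsq -avgZ; apply: eq_avg => i; rewrite -(sqrrN (a - _)) opprB.
Qed.

Lemma flow_empirical r a v : 0 < v -> flow mu0 r (a +i* v) =
  (a + r * mean_inv lam a v) +i* (v * (1 - r * mean_invsq lam a v)).
Proof.
move=> v0; rewrite /flow stieltjes_empirical//.
by apply/eqP; rewrite eq_complex/=; apply/andP; split; apply/eqP; ring.
Qed.

Lemma Lambda_empirical t a v : 0 <= t ->
  Lambda mu0 t (a +i* v) <-> 0 < v /\ t * mean_invsq lam a v < 1.
Proof.
move=> t0; rewrite /Lambda/=.
have E : 0 < v -> 0 < t ->
    (\int[mu0]_x ((ComplexField.Normc.normc (a +i* v - x%:C) ^+ 2)^-1)%:E
      < (1 / t)%:E)%E <-> t * mean_invsq lam a v < 1.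
  move=> v0 t1.
  under eq_integral do rewrite sqr_normc_sub.
  rewrite ge0_integral_empirical; last 2 first.
  - apply: continuous_measurable_fun => x; apply: cvgV.
      by rewrite gt_eqF// ltr_wpDl ?sqr_ge0// exprn_gt0.
    apply: cvgD; last exact: cvg_cst.
    apply: cvgM; apply: cvgB; try exact: cvg_cst; exact: cvg_id.
  - by move=> x; rewrite invr_ge0 addr_ge0 ?sqr_ge0.
  by rewrite lte_fin ltr_pdivlMr// mulrC.
split=> -[v0 h]; split=> //.
- move: t0; rewrite le_eqVlt => /predU1P[<-|t1]; first by rewrite mul0r.
  by apply/E => //; exact: h.
- by move=> t1; apply/E.
Qed.

Lemma mu0_atom (A : set R) i : A (lam i) -> (0 < mu0 A)%E.
Proof.
move=> Ai; rewrite /mu0/= /empirical mule_gt0// ?lte_fin ?invr_gt0 ?ltr0n//.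
apply: (@lt_le_trans _ _ (\d_(lam i) A)); first by rewrite diracE mem_set// lte_fin.
by rewrite (bigD1 i)//= leeDl// sume_ge0.
Qed.

Lemma msupport_empirical i : msupport mu0 (lam i).
Proof. by move=> U _ Ui; exact: mu0_atom Ui. Qed.

Lemma mu0_itv h : mu0 [set` `[- h, 0]] = (avg lam (fun y => (- h <= y <= 0)%R%:R))%:E.
Proof.
rewrite /mu0/= /empirical /avg EFinM -sumEFin; congr (_ * _)%E.
apply: eq_bigr => i _; rewrite diracE; congr (_%:R%:E); congr nat_of_bool.
by apply/idP/idP; rewrite inE/= in_itv/=.
Qed.

End empirical_transform.

(** * Poisson integrals and the support of a probability measure *)

Section poisson.
Context {R : realType} (P : probability (measurableTypeR R) R).
Implicit Types (a v x c M : R).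

Let measurable_poisson a v : 0 < v ->
  measurable_fun setT (fun x => (v / ((x - a) ^+ 2 + v ^+ 2))%:E).
Proof.
move=> v0; apply/measurable_EFinP.
by apply: measurable_kernel => // x; exact: cvg_cst.
Qed.

Let poisson_ge0 a v x : 0 < v -> (0 <= (v / ((x - a) ^+ 2 + v ^+ 2))%:E)%E.
Proof. by move=> v0; rewrite lee_fin divr_ge0// ltW// denom_gt0. Qed.

Let integral_poisson_le a v M (N : set (measurableTypeR R)) : 0 < v -> 0 <= M ->
  measurable N -> P N = 0 ->
  (forall x, ~ N x -> v / ((x - a) ^+ 2 + v ^+ 2) <= M) ->
  (\int[P]_x (v / ((x - a) ^+ 2 + v ^+ 2))%:E <= M%:E)%E.
Proof.
move=> v0 M0 mN PN0 hM.
apply: (@le_trans _ _ (\int[P]_x (cst M x)%:E)%E); last first.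
  by rewrite (integral_cst P measurableT M%:E)//= probability_setT mule1.
apply: ae_ge0_le_integral => //.
- by move=> x _; exact: poisson_ge0.
- exact: measurable_poisson.
- exact/measurable_EFinP.
- have : P.-negligible N by exact/negligibleP.
  apply: (@negligibleS _ _ _ P N) => x /=; apply: contra_notP => Nx _.
  by rewrite lee_fin; exact: hM.
Qed.

Lemma Im_stieltjes_le a v M (N : set (measurableTypeR R)) : 0 < v -> 0 <= M ->
  measurable N -> P N = 0 ->
  (forall x, ~ N x -> v / ((x - a) ^+ 2 + v ^+ 2) <= M) ->
  complex.Im (stieltjes P (a +i* v)) <= M.
Proof.
move=> v0 M0 mN PN0 hM; rewrite stieltjesE/= /Rintegral -lee_fin fineK.
  exact: (integral_poisson_le v0 M0 mN PN0).
rewrite ge0_fin_numE; last by apply: integral_ge0 => x _; exact: poisson_ge0.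
exact: le_lt_trans (integral_poisson_le v0 M0 mN PN0 hM) (ltry _).
Qed.

Lemma Im_stieltjes_ge a v c (I : set (measurableTypeR R)) : 0 < v -> 0 <= c ->
  measurable I -> (forall x, I x -> c <= v / ((x - a) ^+ 2 + v ^+ 2)) ->
  (c%:E * P I <= (complex.Im (stieltjes P (a +i* v)))%:E)%E.
Proof.
move=> v0 c0 mI hc; rewrite stieltjesE/= /Rintegral fineK; last first.
  rewrite ge0_fin_numE; last by apply: integral_ge0 => x _; exact: poisson_ge0.
  apply: (@le_lt_trans _ _ (v^-1)%:E); last exact: ltry.
  apply: (@integral_poisson_le _ _ _ set0) => //; first by rewrite invr_ge0 ltW.
  move=> x _; rewrite ler_pdivrMr ?denom_gt0//.
  by rewrite ler_pdivlMl// expr2 lerDr sqr_ge0.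
rewrite -integral_cst//.
apply: (@le_trans _ _ (\int[P]_(x in I) (v / ((x - a) ^+ 2 + v ^+ 2))%:E)%E).
  apply: ge0_le_integral => //=.
  exact: measurable_funTS (measurable_poisson a v0).
apply: ge0_subset_integral => //; first exact: measurable_poisson.
by move=> x _; exact: poisson_ge0.
Qed.

(** Every point off the support has a null ball of rational centre and radius,
    and there are countably many of those. *)
Lemma null_off_msupport (U : set R) : open U -> U `&` msupport P = set0 -> P U = 0.
Proof.
move=> oU US.
pose V (q : rat * rat) : set (measurableTypeR R) := ball (ratr q.1 : R) (ratr q.2).
pose F k : set (measurableTypeR R) :=
  if unpickle k is Some q then if P (V q) == 0 then V q else set0 else set0.
have mF k : measurable (F k).
  rewrite /F; case: unpickle => // q; case: ifP => _ //; exact: measurable_ball.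
have F0 k : P.-negligible (F k).
  apply/negligibleP => //; rewrite /F; case: unpickle => [q|]; last exact: measure0.
  by case: ifPn => [/eqP //|_]; exact: measure0.
apply: measure_negligible; first exact: open_measurable.
apply: negligibleS (negligible_bigcup F0) => x Ux.
have [W [oW Wx PW]] : exists W : set R, [/\ open W, W x & P W = 0].
  apply: contrapT => noW; have : (U `&` msupport P) x.
    split=> // W oW Wx; rewrite lt0e measure_ge0 andbT; apply/eqP => PW.
    by apply: noW; exists W.
  by rewrite US.
have [c [r [/set_mem cx cW]]] := open_subball_rat oW (mem_set Wx).
exists (pickle (c, r)); [exact: I|rewrite /F pickleK].
have -> : P (V (c, r)) = 0.
  apply: (@subset_measure0 _ _ _ P _ W) => //.
    exact: measurable_ball.
  exact: open_measurable.
by rewrite eqxx.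
Qed.

End poisson.

(** * The right edge of the free convolution *)

Section edge.
Context {R : realType} {n : nat} (hn : (0 < n)%N) (lam : 'I_n -> R).
Context (r : R) (r0 : 0 <= r) (P : probability (measurableTypeR R) R).
Let mu0 : {measure set (measurableTypeR R) -> \bar R} := empirical lam.
Hypothesis convP : is_semicircle_convolution mu0 r P.
Local Notation S := (mean_invsq lam).
Local Notation A := (mean_inv lam).
Local Notation above := (above lam).
Implicit Types (a v w x l : R).

Definition real_flow w := w + r * A w 0.
Local Notation G := real_flow.

(* imaginary part of m_r(G_r(z)) = m0(z) at z = a + iv *)
Let Im_conv a v : 0 < v -> r * S a v < 1 ->
  complex.Im (stieltjes P ((a + r * A a v) +i* (v * (1 - r * S a v)))) = v * S a v.
Proof.
move=> v0 rS; rewrite -flow_empirical// convP ?stieltjes_empirical//.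
exact/Lambda_empirical.
Qed.

(* Moving up by l changes the real part of the flow by at most l / 2, since
   1 / p - p / (p^2 + l^2) <= l / (2 p^2). *)
Let Re_flow_shift w l : above w -> 0 < l -> r * S w 0 <= 1 ->
  G w - l / 2 <= w + r * A w l <= G w.
Proof.
move=> hw l0 rS.
have wl : off_atoms lam w l by exact: above_off.
have w00 : off_atoms lam w 0 by exact: above_off.
have h1 : A w l <= A w 0.
  by have := tangent_le hn hw wl; rewrite subrr mul0r subr_ge0.
have h2 : A w 0 - A w l <= l / 2 * S w 0.
  rewrite /mean_inv /mean_invsq -avgB -avgZ; apply: ler_avg => // i.
  have p0 : 0 < w - lam i by rewrite subr_gt0.
  set p := w - lam i in p0 *; rewrite expr0n addr0.
  have q0 : 0 < p ^+ 2 + l ^+ 2 by rewrite ltr_pwDl ?sqr_ge0// exprn_gt0.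
  rewrite -subr_ge0.
  have -> : l / 2 * (p ^+ 2)^-1 - (p / p ^+ 2 - p / (p ^+ 2 + l ^+ 2)) =
            l * (p - l) ^+ 2 / (2 * p ^+ 2 * (p ^+ 2 + l ^+ 2)).
    by field; rewrite !gt_eqF.
  apply: divr_ge0; first exact: mulr_ge0 (ltW l0) (sqr_ge0 _).
  by apply: mulr_ge0 (ltW q0); apply: mulr_ge0 => //; exact: sqr_ge0.
have S0 : 0 <= S w 0 by apply: ltW; exact: mean_invsq_gt0.
rewrite /G; apply/andP; split; last by rewrite lerD2l ler_wpM2l.
have : r * (A w 0 - A w l) <= r * (l / 2 * S w 0) by rewrite ler_wpM2l.
have : l / 2 * (r * S w 0) <= l / 2 * 1 by rewrite ler_wpM2l// divr_ge0// ltW.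
lra.
Qed.

(* The Poisson kernel at z = G_r(w + il) has height comparable to l and real
   part within l of the interval, hence is of order 1 / l there, whereas its
   integral v S is of order l. *)
Let mass_interval_le w1 w l : above w1 -> r * S w1 0 < 1 -> w1 <= w -> 0 < l ->
  (P [set` `[G w, (G w + l)%R]] <= (5 * S w1 0 / (1 - r * S w1 0) * l ^+ 2)%R%:E)%E.
Proof.
move=> hw1 rS1 w1w l0.
have hw : above w by move=> i; exact: lt_le_trans (hw1 i) w1w.
have S1 : 0 < S w1 0 by apply: mean_invsq_gt0 => //; exact: above_off.
have Sl0 : 0 < S w l by apply: mean_invsq_gt0 => //; exact: above_off.
have SwS1 : S w 0 <= S w1 0 by exact: mean_invsq_anti.
have SlS1 : S w l <= S w1 0.
  by apply: mean_invsq_anti => //; rewrite expr0n sqr_ge0.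
have rSw : r * S w 0 <= r * S w1 0 by rewrite ler_wpM2l.
have rSl : r * S w l <= r * S w1 0 by rewrite ler_wpM2l.
have rSl0 : 0 <= r * S w l by rewrite mulr_ge0// ltW.
have c0 : 0 < 1 - r * S w1 0 by rewrite subr_gt0.
have /andP[E1 E2] := Re_flow_shift hw l0 (le_trans rSw (ltW rS1)).
have ImE := Im_conv l0 (le_lt_trans rSl rS1).
set E' := w + r * A w l in E1 E2 ImE.
set eta := l * (1 - r * S w l) in ImE.
have eta_ge : (1 - r * S w1 0) * l <= eta.
  by rewrite mulrC ler_wpM2l ?lerD2l ?lerN2// ltW.
have eta_le : eta <= l by apply: ler_piMr; [exact: ltW|lra].
have eta0 : 0 < eta by apply: lt_le_trans eta_ge; rewrite mulr_gt0.
have : (((1 - r * S w1 0) / (5 * l))%R%:E * P [set` `[G w, (G w + l)%R]]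
         <= (complex.Im (stieltjes P (E' +i* eta)))%:E)%E.
  apply: Im_stieltjes_ge => //.
    by rewrite divr_ge0 ?mulr_ge0// ltW.
  move=> x /=; rewrite in_itv/= => /andP[x1 x2].
  rewrite ler_pdivlMr ?denom_gt0// mulrAC ler_pdivrMr ?mulr_gt0//.
  have : (x - E') ^+ 2 + eta ^+ 2 <= 5 * l ^+ 2 by nra.
  nra.
rewrite ImE -lee_pdivlMl ?divr_gt0 ?mulr_gt0// => /le_trans; apply.
rewrite -EFinM lee_fin invf_div.
rewrite [leRHS](_ : _ = 5 * l / (1 - r * S w1 0) * (l * S w1 0)); last by ring.
apply: ler_wpM2l; last by rewrite ler_wpM2l// ltW.
by apply: divr_ge0; [rewrite mulr_ge0// ltW|exact: ltW].
Qed.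

(* The intermediate value theorem applies because G_r(w) >= w. *)
Let real_flow_onto w1 x : above w1 -> G w1 <= x -> exists2 w, w1 <= w & G w = x.
Proof.
move=> hw1 Gx; pose u := Num.max x w1.
have w1u : w1 <= u by rewrite le_max lexx orbT.
have aboveW w : w1 <= w -> above w by move=> w1w i; exact: lt_le_trans (hw1 i) w1w.
have Gu : x <= G u.
  apply: (@le_trans _ _ u); first by rewrite le_max lexx.
  rewrite lerDl mulr_ge0//; apply: (avg_ge0 hn) => i; rewrite divr_ge0 ?subr_ge0//.
    exact/ltW/aboveW.
  exact/ltW/above_off/aboveW.
have [|||w win wE] := @IVT R G w1 u x.
- exact: w1u.
- apply: continuous_in_subspaceT => w; rewrite inE/= in_itv/= => /andP[w1w _].
  apply: cvgD; first exact: cvg_id.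
  apply: cvgM; first exact: cvg_cst.
  apply: continuous_mean_inv; exact/above_off/aboveW.
- by rewrite ge_min le_max Gx Gu orbT.
by exists w => //; move: win; rewrite in_itv/= => /andP[].
Qed.

(* An interval of length l has mass O(l^2), a bound that is divided by two
   each time the interval is split into two halves. *)
Let null_interval w1 x l : above w1 -> r * S w1 0 < 1 -> G w1 <= x -> 0 < l ->
  P [set` `[x, x + l]] = 0.
Proof.
move=> hw1 rS1 Gx l0.
set K := 5 * S w1 0 / (1 - r * S w1 0).
have K0 : 0 <= K.
  rewrite divr_ge0 ?subr_ge0 ?(ltW rS1)// mulr_ge0//.
  by apply/ltW/mean_invsq_gt0 => //; exact: above_off.
have dyadic k : forall x l, G w1 <= x -> 0 < l ->
    (P [set` `[x, (x + l)%R]] <= (K * l ^+ 2 / 2 ^+ k)%R%:E)%E.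
  elim: k => [|k IH] {}x {}l {}Gx {}l0.
    rewrite expr0 divr1; have [w w1w <-] := real_flow_onto hw1 Gx.
    exact: mass_interval_le.
  have l20 : 0 < l / 2 by rewrite divr_gt0.
  have E : [set` `[x, x + l]] `<=`
      [set` `[x, x + l / 2]] `|` [set` `[x + l / 2, x + l / 2 + l / 2]].
    move=> y /=; rewrite !in_itv/= => /andP[y1 y2].
    by case: (leP y (x + l / 2)) => h; [left|right]; apply/andP; split; lra.
  apply: (le_trans (le_measure P _ _ E)); rewrite ?inE; try exact: measurable_itv.
    by apply: measurableU; exact: measurable_itv.
  apply: (le_trans (measureU2 _ _ _)); try exact: measurable_itv.
  have Gx2 : G w1 <= x + l / 2 by lra.
  apply: (le_trans (leeD (IH _ _ Gx l20) (IH _ _ Gx2 l20))).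
  rewrite -EFinD lee_fin le_eqVlt; apply/orP; left; apply/eqP.
  by rewrite (exprS 2 k); field; rewrite expf_neq0.
apply/eqP; rewrite eq_le measure_ge0 andbT.
apply/lee_addgt0Pr => e e0; rewrite add0e.
pose k := Num.bound (K * l ^+ 2 / e).
apply: (le_trans (dyadic k x l Gx l0)); rewrite lee_fin.
rewrite ler_pdivrMr ?exprn_gt0// [leRHS]mulrC -ler_pdivrMr//.
have h : K * l ^+ 2 / e < k%:R.
  apply: archi_boundP; apply: divr_ge0; last exact: ltW.
  exact: mulr_ge0 K0 (sqr_ge0 _).
apply: le_trans (ltW h) _; rewrite -natrX ler_nat.
exact: ltnW (ltn_expl _ _).
Qed.

Let msupport_le w1 : above w1 -> r * S w1 0 < 1 -> ubound (msupport P) (G w1).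
Proof.
move=> hw1 rS1 x Px; rewrite leNgt; apply/negP => Gx.
have := Px [set` `]G w1, x + 1[] (@itv_open _ R _ _).
rewrite /= in_itv/= Gx ltrDl ltr01 => /(_ isT).
apply/negP; rewrite -leNgt.
rewrite -(@null_interval w1 (G w1) (x + 1 - G w1))//; last lra.
rewrite le_measure ?inE//.
by move=> y /=; rewrite !in_itv/= => /andP[y1 y2]; apply/andP; split; lra.
Qed.

(* This rules out the default value of the supremum of the empty set. *)
Let msupport_neq0 : msupport P !=set0.
Proof.
apply/set0P/eqP => P0.
have := null_off_msupport (P := P) openT; rewrite P0 setI0 => /(_ erefl).
by rewrite probability_setT => -[] /eqP; rewrite oner_eq0.
Qed.

(* A point is subcritical when r S < 1, i.e. to the right of x_r. *)
Let edge_le_subcritical w : above w -> r * S w 0 < 1 -> edge P <= G w.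
Proof. by move=> hw rS; apply: sup_le_ub => //; exact: msupport_le. Qed.

Let S_right_lt x d : above x -> 0 < d -> S (x + d) 0 < S x 0.
Proof.
move=> hx d0; apply: ltr_avg => // i; have := hx i => xi.
by rewrite ltf_pV2 ?posrE; nra.
Qed.

(** The subcritical points cover only the right of [x_r]; letting them tend to
    [x_r], where the convex function [real_flow] is minimal, gives all others. *)
Lemma edge_le w : above w -> edge P <= G w.
Proof.
move=> hw; case: (ltP (r * S w 0) 1) => [|rS]; first exact: edge_le_subcritical.
have rgt0 : 0 < r.
  by rewrite lt_neqAle r0 andbT; apply/eqP => rE; move: rS; rewrite -rE; lra.
have [x hx rSx] := exists_critical hn lam rgt0.
have Gxw : G x <= G w.
  have := tangent_le hn hw (above_off hx 0).
  move=> /(ler_wpM2l r0); rewrite mulrCA rSx mulr1 mulrBr /G; lra.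
apply: le_trans Gxw; apply/ler_addgt0Pr => d d0.
have hxd : above (x + d) by move=> i; rewrite (lt_trans (hx i))// ltrDl.
apply: (@le_trans _ _ (G (x + d))).
  by apply: edge_le_subcritical => //; rewrite -[ltRHS]rSx ltr_pM2l// S_right_lt.
have := tangent_le hn hx (above_off hxd 0).
have Sxd := mean_invsq_gt0 hn (above_off hxd 0).
move=> /(ler_wpM2l r0); rewrite /G.
have : 0 <= r * ((x + d - x) * S (x + d) 0).
  by rewrite mulr_ge0// mulr_ge0 ?ltW//; lra.
lra.
Qed.

(** If [mu_r] had no mass right of [E = edge P < real_flow x], put
    [d = real_flow x - E].  For [z = x + i eps] with [eps <= d], the flow of z
    stays at distance [d / 2] from the support, so that
    [eps * S = Im m_r <= 4 * eps * (1 - r * S) / d^2].  As eps tends to 0, the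
    left side is of order eps and the right side is o(eps). *)
Lemma edge_critical x : above x -> r * S x 0 = 1 -> edge P = G x.
Proof.
move=> hx rSx; apply/eqP; rewrite eq_le edge_le//= leNgt; apply/negP => egap.
have rgt0 : 0 < r.
  by rewrite lt_neqAle r0 andbT; apply/eqP => rE; move: rSx; rewrite -rE; lra.
have null : P [set` `]edge P, +oo[] = 0.
  apply: null_off_msupport; first exact: rray_open.
  apply/seteqP; split => // y [/=]; rewrite in_itv/= andbT => ey Py.
  have hx1 : above (x + 1) by move=> i; rewrite (lt_trans (hx i))// ltrDl.
  have ubP : has_ubound (msupport P).
    exists (G (x + 1)); apply: msupport_le => //.
    by rewrite -[ltRHS]rSx ltr_pM2l// S_right_lt.
  have : y <= edge P by exact: ub_le_sup.
  by rewrite leNgt ey.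
have [i0 hi0] := exists_top_atom hn lam.
pose m := x - lam i0; have m0 : 0 < m by rewrite subr_gt0.
pose d := G x - edge P; have d0 : 0 < d by rewrite subr_gt0.
(* eps = k m, where m is the distance from x to the atoms: k is small enough
   that eps <= d, and that 1 - r S <= k^2 contradicts r S <= (4 r / d^2)(1 - r S) *)
pose k := (2 + 4 * r / d ^+ 2 + m / d)^-1.
have rd0 : 0 < 4 * r / d ^+ 2 by rewrite !(divr_gt0, mulr_gt0, exprn_gt0).
have md0 : 0 < m / d by rewrite divr_gt0.
have kE : k * (2 + 4 * r / d ^+ 2 + m / d) = 1.
  by rewrite /k mulVf// gt_eqF//; lra.
have k0 : 0 < k by rewrite invr_gt0; lra.
pose eps := k * m; have eps0 : 0 < eps by rewrite mulr_gt0.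
have epsd : eps <= d.
  have -> : eps = k * (m / d) * d by rewrite /eps; field; rewrite gt_eqF.
  rewrite -[leRHS]mul1r ler_wpM2r ?(ltW d0)// -[leRHS]kE ler_pM2l//; lra.
have S_close : S x 0 - S x eps <= k ^+ 2 * S x 0.
  rewrite /mean_invsq -avgB -avgZ; apply: ler_avg => // i.
  have mp : m <= x - lam i by rewrite lerD2l lerN2.
  set p := x - lam i in mp *; rewrite expr0n addr0.
  have p0 : 0 < p by exact: lt_le_trans mp.
  have q0 : 0 < p ^+ 2 + eps ^+ 2 by rewrite ltr_pwDl ?sqr_ge0// exprn_gt0.
  have -> : (p ^+ 2)^-1 - (p ^+ 2 + eps ^+ 2)^-1 =
            eps ^+ 2 / (p ^+ 2 + eps ^+ 2) * (p ^+ 2)^-1.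
    by field; rewrite !gt_eqF.
  rewrite ler_wpM2r ?invr_ge0 ?sqr_ge0// ler_pdivrMr// /eps exprMn.
  rewrite ler_wpM2l ?sqr_ge0//; nra.
have S_lt : S x eps < S x 0.
  apply: ltr_avg => // i; have xi := hx i.
  by rewrite ltf_pV2 ?posrE ?above_off// expr0n addr0 ltrDl exprn_gt0.
have rS_lt : r * S x eps < 1 by rewrite -[ltRHS]rSx ltr_pM2l.
have rS_le : r * S x 0 <= 1 by rewrite rSx.
have /andP[E1 _] := Re_flow_shift hx eps0 rS_le.
have ImE := Im_conv eps0 rS_lt.
set E' := x + r * A x eps in E1 ImE.
set eta := eps * (1 - r * S x eps) in ImE.
have eta0 : 0 < eta by rewrite mulr_gt0// subr_gt0.
have : complex.Im (stieltjes P (E' +i* eta)) <= 4 * eta / d ^+ 2.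
  apply: (Im_stieltjes_le _ _ _ null) => //.
  - by rewrite divr_ge0 ?sqr_ge0// mulr_ge0// ltW.
  move=> y /= /negP; rewrite in_itv/= andbT -leNgt => ye.
  rewrite ler_pdivrMr ?denom_gt0// mulrAC ler_pdivlMr ?exprn_gt0//.
  have : d ^+ 2 <= 4 * ((y - E') ^+ 2 + eta ^+ 2).
    have : d / 2 <= E' - y by have dE : d = G x - edge P by []; lra.
    nra.
  nra.
rewrite ImE /eta (_ : 4 * _ / _ = eps * (4 * (1 - r * S x eps) / d ^+ 2));
  last by ring.
rewrite ler_pM2l//.
move=> h.
have h2 : 1 - r * S x eps <= k ^+ 2.
  rewrite -{1}rSx -mulrBr -[leRHS]mulr1 -rSx [leRHS]mulrCA.
  exact: ler_wpM2l.
have h3 : r * S x eps <= 4 * r / d ^+ 2 * (1 - r * S x eps).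
  by have := ler_wpM2l r0 h; lra.
have h4 : 4 * r / d ^+ 2 * (1 - r * S x eps) <= 4 * r / d ^+ 2 * k ^+ 2.
  by rewrite ler_pM2l//; lra.
have kle : k <= 1 / 2 by nra.
have : k * k <= k * 1 by rewrite ler_pM2l//; lra.
nra.
Qed.

End edge.

(** * Integrating a differential inequality for a square root *)

Section sqrt_decay.
Context {R : realType}.
Implicit Types (a b e rho beta s t : R).

(* Squaring loses the second-order term e^2, which the factor 1 - rho absorbs
   once e is small compared with a. *)
Let sqrt_step a e rho b : 0 < a -> 0 <= e -> 0 < rho < 1 -> e <= 2 * rho * a ->
  a ^+ 2 + 2 * e * a <= b -> a + (1 - rho) * e <= Num.sqrt b.
Proof.
move=> a0 e0 /andP[rho0 rho1] small ab.
have z0 : 0 <= a + (1 - rho) * e by apply: addr_ge0; [exact: ltW|apply: mulr_ge0 => //; lra].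
rewrite -(ger0_norm z0) -sqrtr_sqr; apply: ler_wsqrtr; apply: le_trans ab.
have h1 : (1 - rho) ^+ 2 * e <= 2 * rho * a.
  apply: le_trans small; rewrite ler_piMl//.
  by rewrite expr_le1//; lra.
have := ler_wpM2l e0 h1; nra.
Qed.

(** The discrete form of [f' <= - beta * sqrt f], which makes [sqrt f] decrease
    at rate [beta / 2].  It is phrased with differences because kappa is known
    only through comparisons between two times. *)
Lemma sqrt_decay (f : R -> R) beta s t : 0 <= beta -> s <= t -> 0 <= f t ->
  (forall r, s <= r < t -> 0 < f r) ->
  (forall r r', s <= r -> r <= r' -> r' <= t ->
     f r' + beta * (r' - r) * Num.sqrt (f r') <= f r) ->
  Num.sqrt (f t) + beta / 2 * (t - s) <= Num.sqrt (f s).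
Proof.
move=> beta0; rewrite le_eqVlt => /predU1P[<-|st] ft0 fpos fstep.
  by rewrite subrr mulr0 addr0.
have mono r r' : s <= r -> r <= r' -> r' <= t -> Num.sqrt (f r') <= Num.sqrt (f r).
  move=> sr rr' r't; apply: ler_wsqrtr; apply: le_trans (fstep r r' sr rr' r't).
  by rewrite lerDl !mulr_ge0 ?subr_ge0 ?sqrtr_ge0.
have main rho : 0 < rho < 1 ->
    Num.sqrt (f t) + (1 - rho) ^+ 2 * (beta / 2 * (t - s)) <= Num.sqrt (f s).
  move=> /andP[rho0 rho1]; have ts0 : 0 < t - s by rewrite subr_gt0.
  (* f may vanish at t, so the partition starts slightly before t *)
  pose t' := t - rho * (t - s).
  have t't : t' < t by rewrite ltrBlDr ltrDl mulr_gt0.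
  have st' : s < t' by rewrite /t'; nra.
  have a0 : 0 < Num.sqrt (f t') by rewrite sqrtr_gt0 fpos// (ltW st').
  set a := Num.sqrt (f t') in a0.
  pose N := (Num.bound (beta / 2 * (t' - s) / (2 * rho * a))).+1.
  pose h := (t' - s) / N%:R; have N0 : 0 < N%:R :> R by rewrite ltr0n.
  have h0 : 0 < h by rewrite divr_gt0 ?subr_gt0.
  have e0 : 0 <= beta / 2 * h by apply: mulr_ge0; [exact: divr_ge0|exact: ltW].
  have small : beta / 2 * h <= 2 * rho * a.
    have ra0 : 0 < 2 * rho * a by rewrite !mulr_gt0.
    rewrite /h mulrA ler_pdivrMr// [leRHS]mulrC -ler_pdivrMr//.
    have q0 : 0 <= beta / 2 * (t' - s) / (2 * rho * a).
      apply: divr_ge0; last exact: ltW.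
      by apply: mulr_ge0; [exact: divr_ge0|rewrite subr_ge0 ltW].
    by apply: (le_trans (ltW (archi_boundP q0))); rewrite ler_nat.
  have NhE : N%:R * h = t' - s by rewrite mulrC /h mulfVK// gt_eqF.
  have steps k : (k <= N)%N ->
      a + (1 - rho) * (k%:R * (beta / 2 * h)) <= Num.sqrt (f (t' - k%:R * h)).
    elim: k => [_|k IH kN]; first by rewrite !mul0r subr0 mulr0 addr0.
    have kh : k.+1%:R * h <= t' - s.
      by rewrite -NhE ler_wpM2r ?(ltW h0)// ler_nat.
    have k1 : k.+1%:R = k%:R + 1 :> R by rewrite natr1.
    have {IH} := IH (ltnW kN); set w := t' - k%:R * h => IH.
    have hk0 : 0 <= k%:R * h by rewrite mulr_ge0// ltW.
    have wt : w <= t' by rewrite /w; lra.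
    have sw : s <= w - h by rewrite /w; rewrite k1 in kh; lra.
    have aw : a <= Num.sqrt (f w).
      by apply: le_trans IH; rewrite lerDl !mulr_ge0 ?subr_ge0// ltW.
    have -> : t' - k.+1%:R * h = w - h by rewrite k1 /w; ring.
    have := @sqrt_step (Num.sqrt (f w)) (beta / 2 * h) rho (f (w - h)).
    have fw : 0 <= f w.
      by rewrite ltW// fpos//; apply/andP; split; lra.
    rewrite sqr_sqrtr// rho0 rho1 => /(_ (lt_le_trans a0 aw) e0 isT) step.
    have {}step : Num.sqrt (f w) + (1 - rho) * (beta / 2 * h) <= Num.sqrt (f (w - h)).
      apply: step.
        by apply: (le_trans small); rewrite ler_wpM2l// mulr_ge0// ltW.
      have := fstep (w - h) w sw; rewrite (_ : w - (w - h) = h); last by ring.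
      rewrite (_ : 2 * (beta / 2 * h) = beta * h); last by field.
      by apply; lra.
    by rewrite k1; lra.
  have := steps N (leqnn N).
  rewrite (_ : N%:R * (beta / 2 * h) = beta / 2 * (N%:R * h)); last by ring.
  rewrite NhE (_ : t' - (t' - s) = s); last by ring.
  have -> : t' - s = (1 - rho) * (t - s) by rewrite /t'; ring.
  have := mono t' t (ltW st') (ltW t't) (lexx t); rewrite -/a; nra.
set X := beta / 2 * (t - s) in main *.
have X0 : 0 <= X by apply: mulr_ge0; [exact: divr_ge0|rewrite subr_ge0 ltW].
apply/ler_addgt0Pr => eps eps0.
pose rho := eps / (2 * (X + eps)).
have Xe : 0 < X + eps by lra.
have rho0 : 0 < rho by rewrite divr_gt0// mulr_gt0.
have rhoE : rho * (2 * (X + eps)) = eps by rewrite mulfVK// gt_eqF// mulr_gt0.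
have rho1 : rho < 1 by nra.
have := main rho; rewrite rho0 rho1 => /(_ isT).
nra.
Qed.

End sqrt_decay.

(** * Repulsion from the edge *)

Section edge_repulsion.
Context {R : realType} {n : nat} (hn : (0 < n)%N) (lam : 'I_n -> R).
Hypothesis lam_le0 : forall i, lam i <= 0.
Context (b etas T : R) (b0 : 0 <= b) (etas0 : 0 < etas) (T0 : 0 < T).
Hypothesis mass : forall h, etas <= h <= T ^+ 2 ->
  b * (h * Num.sqrt h) <= avg lam (fun y => (- h <= y <= 0)%R%:R).
Local Notation S := (mean_invsq lam).
Local Notation A := (mean_inv lam).
Context (r x : R) (r0 : 0 < r) (hx : above lam x) (rSx : r * S x 0 = 1).

(** Otherwise all atoms in [[- etas, 0]], of total mass at least
    [b * etas^(3/2)], lie within [2 * etas] of x, so that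
    [1 / r = S >= b / (4 * sqrt etas)]. *)
Lemma critical_ge : 4 * Num.sqrt etas < r * b -> etas <= T ^+ 2 -> etas <= x.
Proof.
move=> rb etasT; rewrite leNgt; apply/negP => xe.
have se0 : 0 < Num.sqrt etas by rewrite sqrtr_gt0.
have := mass; move=> /(_ etas); rewrite lexx etasT => /(_ isT) m.
have : b * (etas * Num.sqrt etas) <= 4 * etas ^+ 2 * S x 0.
  apply: (le_trans m); rewrite /mean_invsq -avgZ; apply: ler_avg => // i.
  have p0 : 0 < x - lam i by rewrite subr_gt0.
  rewrite expr0n addr0; case: (boolP (- etas <= lam i <= 0)) => [/andP[h1 h2]|_].
    by rewrite ler_pdivlMr ?exprn_gt0// mul1r; nra.
  by rewrite mulr_ge0 ?invr_ge0 ?sqr_ge0// mulr_ge0 ?sqr_ge0.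
move=> /(ler_wpM2l (ltW r0)).
rewrite [leRHS]mulrCA rSx mulr1.
have eE : etas = Num.sqrt etas ^+ 2 by rewrite sqr_sqrtr// ltW.
set e := Num.sqrt etas in eE se0 rb *; rewrite {1 2}eE => h.
have : r * b * e ^+ 3 <= 4 * e * e ^+ 3.
  lra.
by rewrite ler_pM2r ?exprn_gt0// leNgt rb.
Qed.

(** All atoms are at distance at least x, so [1 / r = S <= 1 / x^2]. *)
Lemma critical_sqr_le : 0 < x -> x ^+ 2 <= r.
Proof.
move=> x0; rewrite -[leLHS]mulr1 -rSx mulrCA -[leRHS]mulr1 ler_pM2l//.
rewrite -[leRHS](avg_cst hn lam) /mean_invsq -avgZ; apply: ler_avg => // i.
have := lam_le0 i => li; rewrite expr0n addr0 ler_pdivrMr; last first.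
  by rewrite exprn_gt0//; lra.
rewrite mul1r; nra.
Qed.

Context (a v : R) (v0 : 0 < v) (rS : r * S a v < 1).
Let D := A x 0 - A a v.
Let kappa := (a + r * A a v) - (x + r * A x 0).

Let kappaE : kappa = (a - x) - r * D. Proof. by rewrite /kappa /D; ring. Qed.

(** From [kappa = (a - x) - r * D] and [D > (a - x) * S] one gets
    [D * (1 - r * S) > kappa * S].  The strictness, which comes from [v > 0],
    matters when [kappa = 0]. *)
Lemma velocity_gap_gt0 : 0 <= kappa -> 0 < D.
Proof.
move=> k0; have ha := off_atoms_upper lam a v0.
have S0 : 0 < S a v by exact: mean_invsq_gt0.
have : (a - x) * S a v < D by exact: tangent_lt.
have -> : a - x = kappa + r * D by rewrite kappaE; ring.
have kS : 0 <= kappa * S a v by rewrite mulr_ge0// ltW.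
move=> h; have : 0 < D * (1 - r * S a v) by nra.
by rewrite pmulr_lgt0// subr_gt0.
Qed.

Hypotheses (etasx : etas <= x) (xT : x <= T ^+ 2) (k0 : 0 <= kappa) (kT : kappa <= T ^+ 2).

Let d := a - x.
Let D0 : 0 < D. Proof. exact: velocity_gap_gt0. Qed.
Let kd : kappa <= d.
Proof. by rewrite kappaE lerBlDr lerDl mulr_ge0// ltW. Qed.
Let d0 : 0 <= d. Proof. exact: le_trans kd. Qed.
Let x0 : 0 < x. Proof. exact: lt_le_trans etasx. Qed.

(* D is at least its value at height 0 with the same d = a - x. *)
Let D_ge : avg lam (fun y => d / ((x - y) * (x - y + d))) <= D.
Proof.
rewrite /D /mean_inv -avgB; apply: ler_avg => // i.
have p0 : 0 < x - lam i by rewrite subr_gt0.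
have -> : a - lam i = x - lam i + d by rewrite /d; ring.
set p := x - lam i in p0 *; rewrite expr0n addr0.
have q0 : 0 < p + d by exact: ltr_pwDl.
have w0 : 0 < (p + d) ^+ 2 + v ^+ 2 by rewrite ltr_wpDl ?sqr_ge0// exprn_gt0.
rewrite -subr_ge0.
have -> : p / p ^+ 2 - (p + d) / ((p + d) ^+ 2 + v ^+ 2) - d / (p * (p + d)) =
    v ^+ 2 / ((p + d) * ((p + d) ^+ 2 + v ^+ 2)).
  by field; rewrite !gt_eqF.
apply: divr_ge0; first exact: sqr_ge0.
by apply: mulr_ge0; exact: ltW.
Qed.

(* Keep only the atoms in [-h, 0], which are within 2 h of x. *)
Let D_ge_mass h : x <= h -> h <= T ^+ 2 ->
  b * (h * Num.sqrt h) * (d / (2 * h * (2 * h + d))) <= D.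
Proof.
move=> xh hT; apply: le_trans D_ge; have d_ge0 := d0.
have h0 : 0 < h by exact: lt_le_trans xh.
have den0 : 0 < 2 * h * (2 * h + d) by rewrite mulr_gt0//; lra.
have c0 : 0 <= d / (2 * h * (2 * h + d)) by rewrite divr_ge0// ltW.
apply: (@le_trans _ _ (d / (2 * h * (2 * h + d)) *
    avg lam (fun y => (- h <= y <= 0)%R%:R))).
  by rewrite mulrC ler_wpM2l// mass// (le_trans etasx xh).
rewrite -avgZ; apply: ler_avg => // i.
have p0 : 0 < x - lam i by rewrite subr_gt0.
case: (boolP (- h <= lam i <= 0)) => [/andP[h1 h2]|_].
  rewrite mulr1 ler_wpM2l// lef_pV2 ?posrE ?mulr_gt0//; try lra.
  by apply: ler_pM; lra.
by rewrite mulr0 divr_ge0// mulr_ge0//; lra.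
Qed.

(** The window [[- h, 0]] is taken with [h = max x (min d T^2)].  If [d <= x],
    the identity [1 = r * S x 0] improves [kappa <= d] to [kappa <= d^2 / x],
    which is what the window [h = x] yields; if [x < d <= T^2] or [d > T^2],
    then [h = d] or [h = T^2] suffices, by [kappa <= d] or [kappa <= T^2].
    The factor 6 comes from [2 * h * (2 * h + d) <= 6 * h * max h d]. *)
Lemma velocity_gap_ge : b / 6 * Num.sqrt kappa <= D.
Proof.
have [x_gt0 d_ge0 k_le_d] := And3 x0 d0 kd.
have le_small h : 0 < h -> d <= h -> x <= h -> h <= T ^+ 2 ->
    b * (d / Num.sqrt h) / 6 <= D.
  move=> h0 dh xh hT; apply: le_trans (D_ge_mass xh hT).
  have sh0 : 0 < Num.sqrt h by rewrite sqrtr_gt0.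
  have hE : h = Num.sqrt h ^+ 2 by rewrite sqr_sqrtr// ltW.
  have -> : b * (d / Num.sqrt h) / 6 =
      b * (h * Num.sqrt h) * (d / (2 * h * (3 * h))).
    by move: sh0 hE; set e := Num.sqrt h => e0 ->; field; rewrite gt_eqF.
  rewrite ler_wpM2l ?mulr_ge0 ?(ltW h0) ?(ltW sh0)//.
  rewrite ler_wpM2l// lef_pV2 ?posrE ?mulr_gt0//; try lra.
  by rewrite ler_pM2l ?mulr_gt0//; lra.
have le_large h : 0 < h -> h <= d -> x <= h -> h <= T ^+ 2 ->
    b * Num.sqrt h / 6 <= D.
  move=> h0 hd xh hT; apply: le_trans (D_ge_mass xh hT).
  have dgt0 : 0 < d by exact: lt_le_trans hd.
  have -> : b * Num.sqrt h / 6 = b * (h * Num.sqrt h) * (d / (2 * h * (3 * d))).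
    by field; rewrite !gt_eqF.
  rewrite ler_wpM2l ?mulr_ge0 ?(ltW h0) ?sqrtr_ge0//.
  rewrite ler_wpM2l// lef_pV2 ?posrE ?mulr_gt0//; try lra.
  by rewrite ler_pM2l ?mulr_gt0//; lra.
rewrite mulrAC.
have [dx|xd] := leP d x.
  apply: le_trans (le_small x x0 dx (lexx x) xT).
  rewrite ler_wpM2r// ler_wpM2l//.
  have sx0 : 0 < Num.sqrt x by rewrite sqrtr_gt0.
  rewrite -[leRHS]ger0_norm ?divr_ge0 ?(ltW sx0)// -sqrtr_sqr.
  apply: ler_wsqrtr; rewrite expr_div_n sqr_sqrtr ?(ltW x0)//.
  have : (d - d ^+ 2 / x) * S x 0 <= D.
    apply: le_trans D_ge; rewrite /mean_invsq -avgZ; apply: ler_avg => // i.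
    have px : x <= x - lam i by have := lam_le0 i; lra.
    set p := x - lam i in px *; have p0 : 0 < p by exact: lt_le_trans px.
    rewrite expr0n addr0 -subr_ge0.
    have -> : d / (p * (p + d)) - (d - d ^+ 2 / x) / p ^+ 2 =
        d ^+ 2 * (p + d - x) / (x * p ^+ 2 * (p + d)).
      by field; rewrite !gt_eqF//; lra.
    apply: divr_ge0; first by apply: mulr_ge0; [exact: sqr_ge0|lra].
    apply: mulr_ge0; last lra.
    by apply: mulr_ge0; [exact: ltW|exact: sqr_ge0].
  move=> /(ler_wpM2l (ltW r0)); rewrite mulrCA rSx mulr1 kappaE -/d; lra.
have [dT|Td] := leP d (T ^+ 2).
  apply: le_trans (le_large d _ (lexx d) (ltW xd) dT); last exact: lt_trans xd.
  by rewrite ler_wpM2r// ler_wpM2l// ler_wsqrtr.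
apply: le_trans (le_large (T ^+ 2) _ (ltW Td) xT (lexx _)); last by rewrite exprn_gt0.
by rewrite ler_wpM2r// ler_wpM2l// ler_wsqrtr.
Qed.

End edge_repulsion.

(** * The characteristic flow *)

Section characteristic_flow.
Context {R : realType} {n : nat} (hn : (0 < n)%N) (lam : 'I_n -> R).
Let mu0 : {measure set (measurableTypeR R) -> \bar R} := empirical lam.
Context (mu : R -> probability (measurableTypeR R) R).
Hypothesis conv : forall r, 0 <= r -> is_semicircle_convolution mu0 r (mu r).
Local Notation S := (mean_invsq lam).
Local Notation A := (mean_inv lam).
Context (a v : R) (v0 : 0 < v).
Let u := a +i* v.

Lemma flow_kappaE r : flow_kappa mu0 mu u r = a + r * A a v - edge (mu r).
Proof. by rewrite /flow_kappa flow_empirical. Qed.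

Lemma flow_etaE r : flow_eta mu0 u r = v * (1 - r * S a v).
Proof. by rewrite /flow_eta flow_empirical. Qed.

Lemma flow_kappa_critical r x : 0 <= r -> above lam x -> r * S x 0 = 1 ->
  flow_kappa mu0 mu u r = a + r * A a v - (x + r * A x 0).
Proof.
by move=> r0 hx rSx; rewrite flow_kappaE (edge_critical hn r0 (conv r0) hx rSx).
Qed.

(** The critical point x of time r' is a competitor in the minimum defining the
    edge at the earlier time r. *)
Lemma flow_kappa_step r r' x : 0 <= r -> r <= r' -> above lam x -> r' * S x 0 = 1 ->
  flow_kappa mu0 mu u r' + (r' - r) * (A x 0 - A a v) <= flow_kappa mu0 mu u r.
Proof.
move=> r0 rr' hx rSx.
rewrite (flow_kappa_critical (le_trans r0 rr') hx rSx) flow_kappaE.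
have := edge_le hn r0 (conv r0) hx; rewrite /real_flow; lra.
Qed.

End characteristic_flow.

Lemma powR_three_halves (R : realType) (h : R) : 0 <= h ->
  h `^ (3 / 2) = h * Num.sqrt h.
Proof.
move=> h0; have -> : 3 / 2 = 1 + 2^-1 :> R by lra.
rewrite powRD ?powRr1 ?powR12_sqrt//.
by apply/implyP => /eqP; lra.
Qed.

(** As [b < 1], both [C] and [C * b = 2 ^ 21 / b] are at least [2 ^ 21]. *)
Lemma repulsion_constants (R : realType) (b : R) : 0 < b < 1 ->
  let C := 2 ^+ 21 / b ^+ 2 in [/\ 3 <= C, 4 < C * b & C `^ (- (3 / 2)) <= 1 / 3].
Proof.
move=> /andP[b_gt0 b_lt1] C.
have Cb : 4 < C * b.
  have -> : C * b = 2 ^+ 21 / b by rewrite /C; field; rewrite gt_eqF.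
  rewrite ltr_pdivlMr//; have : (4 : R) < 2 ^+ 21 by rewrite -natrX ltr_nat.
  by apply: le_lt_trans; lra.
have C3 : 3 <= C.
  by have : C * b <= C * 1; [rewrite ler_wpM2l ?divr_ge0 ?sqr_ge0// ltW|lra].
split=> //; rewrite powRN mul1r lef_pV2 ?posrE ?powR_gt0//; last lra.
apply: (le_trans C3); rewrite -[leLHS]powRr1; last lra.
by apply: ler_powR; lra.
Qed.


Theorem lemma3p2 (R : realType) (T b etas : R)
  (hT : 100 <= T) (hb : 0 < b < 1) (hetas : 0 < etas < 1 / 4)
  (n : nat) (hn : (0 < n)%N) (lam : 'I_n -> R) :
  let mu0 : {measure set (measurableTypeR R) -> \bar R} := empirical lam in
  let C : R := 2 ^+ 21 / b ^+ 2 in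
  let c : R := b * C `^ (- (3 / 2)) in
  msupport mu0 `<=` `]-oo, 0] ->
  (forall x : R, etas <= x <= T ^+ 2 ->
     ((b * x `^ (3 / 2))%R%:E <= mu0 [set` `[(- x)%R, 0%R]])%E) ->
  forall mu : R -> probability (measurableTypeR R) R,
  (forall r : R, 0 <= r -> is_semicircle_convolution mu0 r (mu r)) ->
  forall (t s : R) (u : R[i]),
  0 < t <= T -> 0 <= s <= t -> Lambda mu0 t u ->
  flow_kappa mu0 mu u s <= T ^+ 2 ->
  (0 <= flow_kappa mu0 mu u t ->
     [/\ (flow_eta mu0 u s / flow_eta mu0 u t - 1) * flow_kappa mu0 mu u t
           <= flow_kappa mu0 mu u s - flow_kappa mu0 mu u t,
         (flow_eta mu0 u s / flow_eta mu0 u t - 1) * flow_kappa mu0 mu u t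
           = (t - s) * complex.Im (stieltjes (mu t) (flow mu0 t u))
             * (flow_kappa mu0 mu u t / flow_eta mu0 u t) &
         0 <= (t - s) * complex.Im (stieltjes (mu t) (flow mu0 t u))
              * (flow_kappa mu0 mu u t / flow_eta mu0 u t)])
  /\
  (0 <= flow_kappa mu0 mu u t -> C * Num.sqrt etas <= s ->
     c * (t - s) / 4
       <= Num.sqrt (flow_kappa mu0 mu u s) - Num.sqrt (flow_kappa mu0 mu u t)).
Proof.
move=> mu0 C c supp mass0 mu conv t s u /andP[t0 tT] /andP[s0 st] Lu ksT.
have /andP[b_gt0 b_lt1] := hb; have /andP[e_gt0 e_lt] := hetas.
case: u Lu ksT => a v Lu ksT.
have [v0 tS] := (Lambda_empirical lam a v (ltW t0)).1 Lu.
have S0 : 0 < mean_invsq lam a v.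
  by apply: mean_invsq_gt0 => //; exact: off_atoms_upper.
have [x hx tSx] := exists_critical hn lam t0.
have step r r' y := @flow_kappa_step _ _ hn lam mu conv a v v0 r r' y.
have kE r y := @flow_kappa_critical _ _ hn lam mu conv a v v0 r y.
split=> [kt0|kt0 Cs].
  have eta_t : 0 < 1 - t * mean_invsq lam a v by rewrite subr_gt0.
  rewrite !flow_etaE// conv ?stieltjes_empirical ?(ltW t0)//=.
  have ratioE : v * (1 - s * mean_invsq lam a v) / (v * (1 - t * mean_invsq lam a v)) - 1
      = (t - s) * mean_invsq lam a v / (1 - t * mean_invsq lam a v).
    by field; rewrite !gt_eqF.
  split.
  (* with k = kappa_t and D = A(x) - A(u), the claim is D (1 - t S) >= S k *)
  - rewrite ratioE mulrAC ler_pdivrMr//.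
    have := step s t x s0 st hx tSx.
    have := tangent_le hn hx (off_atoms_upper lam a v0).
    have -> : a - x = flow_kappa mu0 mu (a +i* v) t
        + t * (mean_inv lam x 0 - mean_inv lam a v).
      by rewrite (kE t x (ltW t0) hx tSx); ring.
    set k := flow_kappa _ _ _ t; set D := mean_inv lam x 0 - _ => hD hk.
    have hD' : k * mean_invsq lam a v <= D * (1 - t * mean_invsq lam a v) by lra.
    have ts0 : 0 <= t - s by lra.
    have := ler_wpM2l ts0 hD'; have := ler_wpM2r (ltW eta_t) hk; lra.
  - by rewrite ratioE; field; rewrite !gt_eqF.
  - apply: mulr_ge0.
      by apply: mulr_ge0; [lra|exact: mulr_ge0 (ltW v0) (ltW S0)].
    by apply: divr_ge0 => //; apply: mulr_ge0; exact: ltW.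
have lam_le0 i : lam i <= 0.
  by have := supp _ (@msupport_empirical _ _ hn lam i); rewrite /= in_itv.
have T0 : 0 < T by lra.
have mass h : etas <= h <= T ^+ 2 ->
    b * (h * Num.sqrt h) <= avg lam (fun y => (- h <= y <= 0)%R%:R).
  move=> hh; have /andP[eh _] := hh; have := mass0 h hh.
  by rewrite mu0_itv// lee_fin powR_three_halves// (le_trans (ltW e_gt0)).
have se0 : 0 < Num.sqrt etas by rewrite sqrtr_gt0.
have [C3 Cb C_small] := repulsion_constants hb.
have spos : 0 < s by apply: lt_le_trans Cs; rewrite mulr_gt0// (lt_le_trans _ C3).
have TT : T <= T ^+ 2 by rewrite expr2 ler_peMl//; lra.
have T2 : etas <= T ^+ 2 by apply: (le_trans _ TT); lra.
have rSu r : r <= t -> r * mean_invsq lam a v < 1.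
  by move=> rt; apply: le_lt_trans tS; rewrite ler_wpM2r// ltW.
have gap_t : 0 < mean_inv lam x 0 - mean_inv lam a v.
  by apply: (velocity_gap_gt0 hn hx v0 tS); rewrite -kE// ltW.
(* kappa stays in [0, T^2] on [s, t], so that velocity_gap_ge applies at each
   of these times *)
have kpos r : s <= r -> r < t -> 0 < flow_kappa mu0 mu (a +i* v) r.
  move=> sr rt; apply: lt_le_trans (step r t x _ (ltW rt) hx tSx); last lra.
  by rewrite ltr_wpDl// mulr_gt0// subr_gt0.
have k_ge0 r : s <= r -> r <= t -> 0 <= flow_kappa mu0 mu (a +i* v) r.
  by move=> sr; rewrite le_eqVlt => /predU1P[->//|rt]; exact/ltW/kpos.
have decay r r' : s <= r -> r <= r' -> r' <= t ->
    flow_kappa mu0 mu (a +i* v) r'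
      + b / 6 * (r' - r) * Num.sqrt (flow_kappa mu0 mu (a +i* v) r')
    <= flow_kappa mu0 mu (a +i* v) r.
  move=> sr rr' r't; have r'0 : 0 < r' by exact: lt_le_trans (le_trans sr rr').
  have [y hy rSy] := exists_critical hn lam r'0.
  have k'0 := k_ge0 r' (le_trans sr rr') r't.
  have kE' := kE r' y (ltW r'0) hy rSy.
  have gap0 : 0 < mean_inv lam y 0 - mean_inv lam a v.
    by apply: (velocity_gap_gt0 hn hy v0 (rSu r' r't)); rewrite -kE'.
  have k'T : flow_kappa mu0 mu (a +i* v) r' <= T ^+ 2.
    apply: le_trans ksT; apply: le_trans (step s r' y s0 (le_trans sr rr') hy rSy).
    by rewrite lerDl mulr_ge0 ?(ltW gap0)// subr_ge0 (le_trans sr).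
  have ey : etas <= y.
    apply: (critical_ge hn e_gt0 mass r'0 hy rSy) => //.
    apply: (@lt_le_trans _ _ (C * Num.sqrt etas * b)).
      by rewrite mulrAC ltr_pM2r.
    by rewrite ler_wpM2r ?(ltW b_gt0)// (le_trans Cs) ?(le_trans sr).
  have y0 : 0 < y by exact: lt_le_trans ey.
  have yT : y <= T ^+ 2.
    have y2 := critical_sqr_le hn lam_le0 r'0 rSy y0.
    apply: (le_trans _ TT); rewrite -ler_sqr ?nnegrE ?(ltW y0) ?(ltW T0)//.
    exact: le_trans (le_trans y2 r't) (le_trans tT TT).
  have gap : b / 6 * Num.sqrt (flow_kappa mu0 mu (a +i* v) r')
      <= mean_inv lam y 0 - mean_inv lam a v.
    rewrite kE'; apply: (velocity_gap_ge hn lam_le0 (ltW b_gt0) e_gt0 T0 mass r'0 hy rSy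
      v0 (rSu r' r't) ey yT); by rewrite -kE'.
  have r0 : 0 <= r by exact: le_trans sr.
  apply: le_trans (step r r' y r0 rr' hy rSy).
  by rewrite lerD2l mulrAC mulrC ler_wpM2l// subr_ge0.
have b6 : 0 <= b / 6 by lra.
have kpos' r : s <= r < t -> 0 < flow_kappa mu0 mu (a +i* v) r.
  by move=> /andP[]; exact: kpos.
have := sqrt_decay b6 st kt0 kpos' decay.
(* beta / 2 = b / 12 dominates c / 4 *)
have cb : c <= b * (1 / 3) by rewrite /c ler_wpM2l// ltW.
have := ler_wpM2r (_ : 0 <= t - s) cb; rewrite subr_ge0 => /(_ st); lra.
Qed.
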